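(* Assume that $d(s,a)>0$ for every $(s,a)$, that $\alpha\in(0,1)$, and that $Q_0$ is deterministic. Let $(Q_k)_{k\ge0}$ be the i.i.d.-observation Q-learning iterates. Fix any $\varepsilon>0$ such that $\beta_\varepsilon:=\rho(\mathcal M_\alpha)+\varepsilon<1$, and let $W_{\max}$ and $K_{\beta_\varepsilon}$ be as defined in the context. Then, for all $k\ge0$, $$\begin{aligned}\mathbb E[\|Q_k-Q^*\|_\infty]\le\;&|\mathcal S|\,|\mathcal A|\sqrt{\frac{\alpha W_{\max}}{d_{\min}(1-\gamma)}}\left(1+\frac{2\gamma d_{\max}}{d_{\min}(1-\gamma)}\right)\\&+K_{\beta_\varepsilon}\beta_\varepsilon^k\|Q_0-Q^*\|_\infty+2\alpha\gamma d_{\max}K_{\beta_\varepsilon}^2\,k\beta_\varepsilon^{k-1}\|Q_0-Q^*\|_\infty,\end{aligned}$$ with the convention that $k\beta_\varepsilon^{k-1}=0$ when $k=0$.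
   Context: MDP. A finite discounted MDP has state space $\mathcal S=\{1,\dots,|\mathcal S|\}$, action space $\mathcal A=\{1,\dots,|\mathcal A|\}$, transition probabilities $P(s'\mid s,a)$, real one-step rewards $r(s,a,s')$, and discount factor $\gamma\in(0,1)$. Put $R(s,a):=\sum_{s'}P(s'\mid s,a)r(s,a,s')$ and $R_{\max}:=\max_{s,a,s'}|r(s,a,s')|$. Q-functions are vectors $Q\in\mathbb R^{|\mathcal S||\mathcal A|}$ indexed by state-action pairs. $P$ also denotes the $(|\mathcal S||\mathcal A|)\times|\mathcal S|$ matrix whose row $(s,a)$ is $P(\cdot\mid s,a)$. A stochastic policy is a map $\mu$ from $\mathcal S$ to probability distributions on $\mathcal A$; $\Pi^\mu$ is the $|\mathcal S|\times(|\mathcal S||\mathcal A|)$ matrix with $(\Pi^\mu Q)(s)=\sum_a\mu(a\mid s)Q(s,a)$. $\Theta$ is the set of deterministic policies $\pi:\mathcal S\to\mathcal A$, identified with one-hot stochastic policies. $V_Q(s):=\max_aQ(s,a)$, $F(Q):=R+\gamma PV_Q$, and $Q^*$ is the unique fixed point of $F$. I.i.d.-observation Q-learning. At each time $k$, $(s_k,a_k)$ is sampled independently (of the past) with $\mathbb P(s_k=s,a_k=a)=d(s,a):=p(s)b(a\mid s)$, where $p$ is a distribution on $\mathcal S$ and $b$ a fixed behavior policy; then $s'_k\sim P(\cdot\mid s_k,a_k)$ and $r_{k+1}:=r(s_k,a_k,s'_k)$. With constant step-size $\alpha$, $Q_{k+1}(s_k,a_k)=Q_k(s_k,a_k)+\alpha\big(r_{k+1}+\gamma\max_uQ_k(s'_k,u)-Q_k(s_k,a_k)\big)$,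 and all other coordinates are unchanged. $d_{\min}:=\min_{s,a}d(s,a)$, $d_{\max}:=\max_{s,a}d(s,a)$. Matrices. $D:=\mathrm{diag}(d(s,a))$; $M_\pi:=I-\alpha D+\alpha\gamma DP\Pi^\pi$; $\mathcal M_\alpha:=\{M_\pi:\pi\in\Theta\}$; $\mathrm{co}(\mathcal M_\alpha)$ is its convex hull. The joint spectral radius of a bounded set $\mathcal H$ of square matrices is $\rho(\mathcal H):=\lim_{k\to\infty}\sup_{A_1,\dots,A_k\in\mathcal H}\|A_k\cdots A_1\|^{1/k}$ (independent of the submultiplicative norm). Constants. $W_{\max}:=\big(R_{\max}+(1+\gamma)\max\{\|Q_0\|_\infty,\tfrac{R_{\max}}{1-\gamma}\}\big)^2$, and $$K_{\beta_\varepsilon}:=\sup_{\ell\ge0}\beta_\varepsilon^{-\ell}\sup_{M_0,\dots,M_{\ell-1}\in\mathrm{co}(\mathcal M_\alpha)}\|M_{\ell-1}\cdots M_0\|_\infty,$$ where $\|\cdot\|_\infty$ on matrices is the induced infinity norm and the product of length zero is the identity. *)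

(* Defs.v *)
From HB Require Import structures.
From mathcomp Require Import all_boot all_order all_algebra.
From mathcomp Require Import all_classical all_reals all_analysis.

Set Implicit Arguments.
Unset Strict Implicit.
Unset Printing Implicit Defensive.

Import Order.TTheory GRing.Theory Num.Theory.
Import numFieldNormedType.Exports.

Local Open Scope classical_set_scope.
Local Open Scope ring_scope.

(* States are 'I_nS.+1 and actions are 'I_nA.+1 (nonempty finite sets);
   state-action pairs index rows and columns of size nS.+1 * nA.+1 through
   [mxvec_index].  Norms `|Q| of column vectors are the library's norm on
   matrices, the largest absolute value of an entry, i.e. the infinity norm. *)

Record mdp (R : realType) (nS nA : nat) := Mdp {
  trans : 'I_nS.+1 -> 'I_nA.+1 -> 'I_nS.+1 -> R;
  reward : 'I_nS.+1 -> 'I_nA.+1 -> 'I_nS.+1 -> R;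
  disc : R;
  trans_ge0 : forall s a s', 0 <= trans s a s';
  trans_sum1 : forall s a, \sum_s' trans s a s' = 1;
  disc_gt0 : 0 < disc;
  disc_lt1 : disc < 1 }.

Definition is_distr (R : realType) (I : finType) (p : I -> R) : Prop :=
  (forall i, 0 <= p i) /\ \sum_i p i = 1.

Section InducedNorm.
Context {R : realType} {N : nat}.
Implicit Types (A : 'M[R]_N) (H : set 'M[R]_N) (M : nat -> 'M[R]_N).

Definition opnorm A : R :=
  sup [set `|A *m x| / `|x| | x in [set x : 'cV[R]_N | x != 0]].

(* M (l-1) *m ... *m M 0, the identity for l = 0 *)
Fixpoint mxprod M (l : nat) : 'M[R]_N :=
  if l is l'.+1 then M l' *m mxprod M l' else 1%:M.

Definition seqs_in H (l : nat) : set (nat -> 'M[R]_N) :=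
  [set M | forall i, (i < l)%N -> H (M i)].

(* The joint spectral radius does not depend on the submultiplicative norm; it
   is taken here with the induced infinity norm. *)
Definition jsr H : R :=
  lim ((fun k => sup [set opnorm (mxprod M k) `^ k%:R^-1 | M in seqs_in H k])
       @ \oo).

Definition convex_hull H : set 'M[R]_N :=
  smallest (fun C : set 'M[R]_N => @convex_set R 'M[R]_N C) H.

Definition growth_const H (beta : R) : R :=
  sup (range (fun l : nat =>
    beta ^- l * sup [set opnorm (mxprod M l) | M in seqs_in (convex_hull H) l])).

End InducedNorm.

Section QLearning.
Context {R : realType} {nS nA : nat}.
Local Notation state := 'I_nS.+1.
Local Notation action := 'I_nA.+1.
Local Notation N := (nS.+1 * nA.+1)%N.
Local Notation qfun := 'cV[R]_N.
Implicit Types (X : mdp R nS nA) (Q : qfun) (d : state -> action -> R).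

Definition qval Q (s : state) (a : action) : R := Q (mxvec_index s a) 0.

Definition qvec (f : state -> action -> R) : qfun :=
  (mxvec (\matrix_(s, a) f s a))^T.

Definition Pmx X : 'M[R]_(N, nS.+1) :=
  \matrix_(i, s') qvec (fun s a => trans X s a s') i 0.

Definition Pimx (mu : state -> action -> R) : 'M[R]_(nS.+1, N) :=
  \matrix_(s, j) qvec (fun s' a => if s' == s then mu s a else 0) j 0.

Lemma qvalK (f : state -> action -> R) s a : qval (qvec f) s a = f s a.
Proof. by rewrite /qval mxE mxvecE mxE. Qed.

Lemma PmxE X s a s' : Pmx X (mxvec_index s a) s' = trans X s a s'.
Proof. by rewrite mxE -[LHS]/(qval (qvec _) s a) qvalK. Qed.

Lemma PimxE (mu : state -> action -> R) Q s :
  (Pimx mu *m Q) s 0 = \sum_a mu s a * qval Q s a.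
Proof.
rewrite mxE (reindex (fun x : state * action => mxvec_index x.1 x.2)) /=; last first.
  by have [g gK Kg] := curry_mxvec_bij nS.+1 nA.+1;
     exists g => [[x u]|i] _; [exact: (gK (x, u)) | rewrite -[RHS]Kg; case: (g i)].
rewrite -(pair_bigA _ (fun x u => Pimx mu s (mxvec_index x u)
                                  * Q (mxvec_index x u) 0)) /=.
have E x u : Pimx mu s (mxvec_index x u) = if x == s then mu s u else 0.
  by rewrite mxE -[LHS]/(qval (qvec _) x u) qvalK.
rewrite (bigD1 s) //= [X in _ + X]big1 ?addr0.
  by apply: eq_bigr => u _; rewrite E eqxx.
by move=> x /negPf xs; rewrite big1 // => u _; rewrite E xs mul0r.
Qed.

Definition onehot (pi : state -> action) (s : state) (a : action) : R :=
  (a == pi s)%:R.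

Definition Dmx d : 'M[R]_N := diag_mx (qvec d)^T.

Definition Mpi X d (alpha : R) (pi : state -> action) : 'M[R]_N :=
  1%:M - alpha *: Dmx d
  + (alpha * disc X) *: (Dmx d *m Pmx X *m Pimx (onehot pi)).

Definition Mset X d (alpha : R) : set 'M[R]_N := range (Mpi X d alpha).

Definition exp_reward X : qfun :=
  qvec (fun s a => \sum_s' trans X s a s' * reward X s a s').

(* The base value of the iterated maximum is one of the maximised values; the
   same device is used in [dmin] and [dmax]. *)
Definition Vmax Q (s : state) : R :=
  \big[Num.max/qval Q s ord0]_(a : action) qval Q s a.

Definition bellman X Q : qfun :=
  exp_reward X + disc X *: (Pmx X *m \col_s Vmax Q s).

Definition dmin d : R :=
  \big[Num.min/d ord0 ord0]_(sa : state * action) d sa.1 sa.2.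
Definition dmax d : R :=
  \big[Num.max/d ord0 ord0]_(sa : state * action) d sa.1 sa.2.

Definition Rmax X : R :=
  \big[Num.max/0]_(t : state * action * state) `|reward X t.1.1 t.1.2 t.2|.

Definition Wmax X Q0 : R :=
  (Rmax X + (1 + disc X) * Num.max `|Q0| (Rmax X / (1 - disc X))) ^+ 2.

Definition q_update X (alpha : R) (s : state) (a : action) (s' : state) Q :
    qfun :=
  qvec (fun x u =>
    if (x == s) && (u == a)
    then qval Q s a
         + alpha * (reward X s a s' + disc X * Vmax Q s' - qval Q s a)
    else qval Q x u).

(* The three sequences are one realisation of the observations. *)
Fixpoint q_iter X (alpha : R) Q0 (s : nat -> state) (a : nat -> action)
    (s' : nat -> state) (k : nat) : qfun :=
  if k is j.+1
  then q_update X alpha (s j) (a j) (s' j) (q_iter X alpha Q0 s a s' j)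
  else Q0.

Section Observations.
Context {disp : measure_display} {Omega : measurableType disp}.
Variable Pr : probability Omega R.
Variables (s : nat -> Omega -> state) (a : nat -> Omega -> action)
          (s' : nat -> Omega -> state).

Definition past (k : nat) (h : nat -> state * action * state) : set Omega :=
  [set w | forall i, (i < k)%N -> (s i w, a i w, s' i w) = h i].

(* All variables are finite-valued, so the events [past k h] are the atoms of
   the sigma-algebra generated by the observations made before time k, and
   independence of the past and the conditional law of s' k need only be stated
   on them. *)
Record iid_observations X d : Prop := IidObservations {
  obs_meas_s : forall k x, measurable [set w | s k w = x];
  obs_meas_a : forall k u, measurable [set w | a k w = u];
  obs_meas_s' : forall k y, measurable [set w | s' k w = y];
  obs_law : forall k x u,
    Pr [set w | s k w = x /\ a k w = u] = (d x u)%:E;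
  obs_indep : forall k h x u,
    Pr (past k h `&` [set w | s k w = x /\ a k w = u])
    = (Pr (past k h) * Pr [set w | s k w = x /\ a k w = u])%E;
  obs_next : forall k h x u y,
    Pr (past k h `&` [set w | s k w = x /\ a k w = u]
                 `&` [set w | s' k w = y])
    = (Pr (past k h `&` [set w | s k w = x /\ a k w = u])
       * (trans X x u y)%:E)%E }.

End Observations.
End QLearning.

(* Main.v *)
(** Writing [e = Q - Qstar], one step of Q-learning reads [e' = M e + noise],
    where [M] is the matrix of a stochastic policy that mixes, in every state,
    the greedy actions of [Q] and of [Qstar]; this [M] lies in the convex hull
    but depends on the past.  The error is compared with the linear system
    driven by the same noise and by the fixed matrix [Ms] of one deterministic
    policy.  There the noise terms are orthogonal, and since [Ms] is a
    contraction of the max norm every coordinate has second moment at most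
    [alpha * Wmax / (dmin * (1 - gamma))].  In the difference of the two systems
    the noise cancels, and only the input [(M - Ms) e_lin] is left, with [e_lin]
    the state of the linear system: its deterministic part is summed with the
    growth bound [K * beta ^ l] for products in the hull, its random part with
    the contraction.

    The growth constant is finite because, by Fekete's argument, the joint
    spectral radius is a limit, and because a bound on all products of [l]
    matrices of a set extends to its convex hull one factor at a time.  All
    expectations at time [k] are sums over the finitely many histories. *)

Require Import Defs.
From HB Require Import structures.
From mathcomp Require Import all_boot all_order all_algebra.
From mathcomp Require Import all_classical all_reals all_analysis.
From mathcomp Require Import measurable_realfun ring lra.

Set Implicit Arguments.
Unset Strict Implicit.
Unset Printing Implicit Defensive.

Import Order.TTheory GRing.Theory Num.Theory.
Import numFieldNormedType.Exports.

Local Open Scope classical_set_scope.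
Local Open Scope ring_scope.

(** * The max norm on vectors and the operator norm it induces *)

Section MaxNorm.
Context {R : realType}.

Lemma cv_norm_le N (x : 'cV[R]_N) (c : R) :
  0 <= c -> (forall i, `|x i 0| <= c) -> `|x| <= c.
Proof.
move=> c0 xc; rewrite [leLHS]/Num.norm /= mx_normrE.
by apply: bigmax_le => // -[i j] _ /=; rewrite (ord1 j).
Qed.

Lemma cv_coord_le N (x : 'cV[R]_N) i : `|x i 0| <= `|x|.
Proof.
rewrite [leRHS]/Num.norm /= mx_normrE.
exact: (le_bigmax _ (fun ij => `|x ij.1 ij.2|) (i, ord0)).
Qed.

Lemma mulmx_norm_le N (A : 'M[R]_N) (x : 'cV[R]_N) :
  `|A *m x| <= (\sum_i \sum_j `|A i j|) * `|x|.
Proof.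
have rowge0 i : 0 <= \sum_j `|A i j| by apply: sumr_ge0.
apply: cv_norm_le => [|i]; first by rewrite mulr_ge0 // sumr_ge0.
apply: (@le_trans _ _ ((\sum_j `|A i j|) * `|x|)); last first.
  by rewrite ler_wpM2r // [leRHS](bigD1 i) //= lerDl sumr_ge0.
rewrite mxE mulr_suml (le_trans (ler_norm_sum _ _ _)) //.
by apply: ler_sum => j _; rewrite normrM ler_wpM2l // cv_coord_le.
Qed.

(* The bound is tested on the vector of signs of the row. *)
Lemma row_sum_le N (A : 'M[R]_N) (c : R) :
  (forall x : 'cV_N, `|A *m x| <= c * `|x|) ->
  0 <= c -> forall i, \sum_j `|A i j| <= c.
Proof.
move=> Ac c0 i; pose x : 'cV[R]_N := \col_j Num.sg (A i j).
have x1 : `|x| <= 1.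
  apply: cv_norm_le => // j; rewrite mxE normr_sg.
  by case: (_ != 0).
have <- : (A *m x) i 0 = \sum_j `|A i j|.
  by rewrite mxE; apply: eq_bigr => j _; rewrite mxE [RHS]normrEsg mulrC.
rewrite (le_trans (ler_norm _)) // (le_trans (cv_coord_le _ _)) //.
by rewrite (le_trans (Ac x)) // -[leRHS]mulr1 ler_wpM2l.
Qed.

(** Weighted Cauchy-Schwarz with weights [|A i j|]. The right side is linear in the squares of the
    coordinates, so an expectation passes through it. *)
Lemma row_square_le N (A : 'M[R]_N) (x : 'cV[R]_N) (c : R) i :
  \sum_j `|A i j| <= c ->
  (A *m x) i 0 ^+ 2 <= c * \sum_j `|A i j| * x j 0 ^+ 2.
Proof.
move=> Ac; set w := fun j => `|A i j|; set y := fun j => `|x j 0|.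
have w0 j : 0 <= w j by exact: normr_ge0.
have S0 : 0 <= \sum_j w j * x j 0 ^+ 2.
  by apply: sumr_ge0 => j _; rewrite mulr_ge0 ?sqr_ge0.
apply: (@le_trans _ _ ((\sum_j w j) * \sum_j w j * x j 0 ^+ 2)); last first.
  exact: ler_wpM2r.
apply: (@le_trans _ _ ((\sum_j w j * y j) ^+ 2)).
  rewrite -real_normK ?num_real // lerXn2r ?nnegrE //.
    by apply: sumr_ge0 => j _; rewrite mulr_ge0 // normr_ge0.
  rewrite mxE (le_trans (ler_norm_sum _ _ _)) //.
  by apply: ler_sum => j _; rewrite normrM.
(* Doubling symmetrises the double sum; term by term the claim is then [(y j - y l) ^+ 2 >= 0]. *)
rewrite -(@ler_pM2l _ 2) //.
have -> : 2 * ((\sum_j w j) * \sum_j w j * x j 0 ^+ 2)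
    = \sum_j \sum_l w j * w l * (x j 0 ^+ 2 + x l 0 ^+ 2).
  transitivity (\sum_j \sum_l w j * (w l * x l 0 ^+ 2)
      + \sum_j \sum_l w l * (w j * x j 0 ^+ 2)).
    rewrite -big_distrlr [X in _ + X]exchange_big -big_distrlr /=.
    by rewrite mulr_natl mulr2n.
  rewrite -big_split; apply: eq_bigr => j _; rewrite -big_split.
  by apply: eq_bigr => l _ /=; ring.
rewrite expr2 big_distrlr mulr_sumr /=; apply: ler_sum => j _.
rewrite mulr_sumr; apply: ler_sum => l _.
have := mulr_ge0 (mulr_ge0 (w0 j) (w0 l)) (sqr_ge0 (y j - y l)).
have -> : x j 0 ^+ 2 = y j ^+ 2 by rewrite real_normK ?num_real.
have -> : x l 0 ^+ 2 = y l ^+ 2 by rewrite real_normK ?num_real.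
by rewrite sqrrB; lra.
Qed.

Lemma opnorm_has_ubound N (A : 'M[R]_N) :
  has_ubound [set `|A *m x| / `|x| | x in [set x : 'cV[R]_N | x != 0]].
Proof.
exists (\sum_i \sum_j `|A i j|) => _ /= [x x0 <-].
by rewrite ler_pdivrMr ?normr_gt0 // mulmx_norm_le.
Qed.

Lemma opnormP N (A : 'M[R]_N) (x : 'cV[R]_N) : `|A *m x| <= opnorm A * `|x|.
Proof.
have [->|x0] := eqVneq x 0; first by rewrite mulmx0 !normr0 mulr0.
rewrite -ler_pdivrMr ?normr_gt0 //.
by apply: ub_le_sup; [exact: opnorm_has_ubound | exists x].
Qed.

Lemma opnorm_le N (A : 'M[R]_N) (c : R) :
  0 <= c -> (forall x : 'cV_N, `|A *m x| <= c * `|x|) -> opnorm A <= c.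
Proof.
move=> c0 Ac; rewrite /opnorm; set S := (X in sup X).
(* In dimension 0 there is no nonzero vector, and the supremum is 0 by convention. *)
have [->|/set0P S0] := eqVneq S set0; first by rewrite sup0.
apply: ge_sup => // _ [x x0 <-].
by rewrite ler_pdivrMr ?normr_gt0.
Qed.

Lemma opnorm_ge0 N (A : 'M[R]_N) : 0 <= opnorm A.
Proof.
rewrite /opnorm; set S := (X in sup X).
have [->|/set0P [y [x x0 xy]]] := eqVneq S set0; first by rewrite sup0.
rewrite (@le_trans _ _ y) //; first by rewrite -xy divr_ge0.
by apply: ub_le_sup; [exact: opnorm_has_ubound | exists x].
Qed.

Lemma opnorm_mulmx_le N (A B : 'M[R]_N) :
  opnorm (A *m B) <= opnorm A * opnorm B.
Proof.
apply: opnorm_le => [|x]; first by rewrite mulr_ge0 ?opnorm_ge0.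
rewrite -mulmxA (le_trans (opnormP _ _)) // -mulrA ler_wpM2l ?opnorm_ge0 //.
exact: opnormP.
Qed.

Lemma opnorm1_le N : opnorm (1%:M : 'M[R]_N) <= 1.
Proof. by apply: opnorm_le => // x; rewrite mul1mx mul1r. Qed.

End MaxNorm.

(** * Matrix products, the joint spectral radius and growth bounds *)

Section JointSpectralRadius.
Context {R : realType} {N : nat}.
Implicit Types (H : set 'M[R]_N) (M : nat -> 'M[R]_N).

Lemma mxprodD M m n :
  mxprod M (m + n) = mxprod (fun i => M (i + n)%N) m *m mxprod M n.
Proof.
elim: m => [|m IH] /=; first by rewrite mul1mx.
by rewrite IH mulmxA.
Qed.

Lemma eq_mxprod M M' l :
  (forall i, (i < l)%N -> M i = M' i) -> mxprod M l = mxprod M' l.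
Proof.
elim: l => //= l IH MM'; rewrite MM' // IH // => i il.
by apply: MM'; rewrite ltnS ltnW.
Qed.

Lemma mxprod_opnorm_le H (c : R) :
  0 <= c -> (forall A, H A -> opnorm A <= c) ->
  forall l M, seqs_in H l M -> opnorm (mxprod M l) <= c ^+ l.
Proof.
move=> c0 Hc; elim=> [|l IH] M HM /=; first by rewrite expr0 opnorm1_le.
rewrite (le_trans (opnorm_mulmx_le _ _)) // exprS ler_pM ?opnorm_ge0 //.
  by apply/Hc/HM.
by apply: IH => i il; apply: HM; rewrite ltnS ltnW.
Qed.

(** Blocks of [m] factors are split off on the left, each costing [t ^+ m]. The remaining [r < m]
    factors cost at most [c ^+ r = (c / t) ^+ r * t ^+ r], and [C] sums these ratios over all [r] to
    dominate each. *)
Lemma mxprod_power_bound H (c t : R) m :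
  1 <= c -> (forall A, H A -> opnorm A <= c) -> 0 < t -> (0 < m)%N ->
  (forall M, seqs_in H m M -> opnorm (mxprod M m) <= t ^+ m) ->
  exists2 C : R, 0 <= C &
    forall l M, seqs_in H l M -> opnorm (mxprod M l) <= C * t ^+ l.
Proof.
move=> c1 Hc t0 m0 Ht.
have c0 : 0 <= c by rewrite (le_trans _ c1).
pose C := \sum_(r < m) (c / t) ^+ r.
have C0 : 0 <= C.
  by apply: sumr_ge0 => r _; rewrite exprn_ge0 // divr_ge0 // ltW.
have Cr r : (r < m)%N -> (c / t) ^+ r <= C.
  move=> rm; rewrite /C (bigD1 (Ordinal rm)) //= lerDl sumr_ge0 // => i _.
  by rewrite exprn_ge0 // divr_ge0 // ltW.
exists C => // l M.
elim/ltn_ind: l M => l IH M HM.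
have [lm|ml] := ltnP l m.
  rewrite (le_trans (mxprod_opnorm_le c0 Hc HM)) //.
  rewrite (le_trans _ (ler_wpM2r (exprn_ge0 _ (ltW t0)) (Cr _ lm))) //.
  by rewrite -exprMn divfK // gt_eqF.
have -> : l = (m + (l - m))%N by rewrite subnKC.
rewrite mxprodD exprD mulrCA (le_trans (opnorm_mulmx_le _ _)) //.
rewrite ler_pM ?opnorm_ge0 //.
  by apply: Ht => i im; apply: HM; rewrite -[ltnRHS](subnKC ml) ltn_add2r.
apply: IH; first by rewrite ltn_subrL m0 (leq_trans m0 ml).
by move=> i il; apply: HM; rewrite (leq_trans il) // leq_subr.
Qed.

Let u H (k : nat) : R :=
  sup [set opnorm (mxprod M k) `^ k%:R^-1 | M in seqs_in H k].

(** The uniform bound [c] makes the set bounded, so that its [sup] is a true upper bound and not a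
    default value. Positivity of [k] allows the root to be undone. *)
Let u_ubound H (c : R) : 1 <= c -> (forall A, H A -> opnorm A <= c) ->
  forall k M, (0 < k)%N -> seqs_in H k M -> opnorm (mxprod M k) <= u H k ^+ k.
Proof.
move=> c1 Hc k M k0 HM.
have c0 : 0 <= c by rewrite (le_trans _ c1).
have root (x : R) : 0 <= x -> (x `^ k%:R^-1) ^+ k = x.
  move=> x0; rewrite -powR_mulrn ?powR_ge0 // -powRrM mulVf ?powRr1 //.
  by rewrite pnatr_eq0 -lt0n.
rewrite -[leLHS]root ?opnorm_ge0 // lerXn2r ?nnegrE ?powR_ge0 //.
  rewrite (@le_trans _ _ (opnorm (mxprod M k) `^ k%:R^-1)) ?powR_ge0 //.
  apply: ub_le_sup; last by exists M.
  exists ((c ^+ k) `^ k%:R^-1) => _ [M' HM' <-].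
  apply: ge0_ler_powR; rewrite ?invr_ge0 ?nnegrE ?opnorm_ge0 ?exprn_ge0 //.
  exact: mxprod_opnorm_le HM'.
apply: ub_le_sup; last by exists M.
exists ((c ^+ k) `^ k%:R^-1) => _ [M' HM' <-].
apply: ge0_ler_powR; rewrite ?invr_ge0 ?nnegrE ?opnorm_ge0 ?exprn_ge0 //.
exact: mxprod_opnorm_le HM'.
Qed.

Let u_le H (t : R) k : H !=set0 -> 0 <= t -> (0 < k)%N ->
  (forall M, seqs_in H k M -> opnorm (mxprod M k) <= t ^+ k) -> u H k <= t.
Proof.
move=> [A HA] t0 k0 Ht; apply: ge_sup.
  by exists (opnorm (mxprod (fun=> A) k) `^ k%:R^-1), (fun=> A).
move=> _ [M HM <-].
have -> : t = (t ^+ k) `^ k%:R^-1.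
  by rewrite -powR_mulrn // -powRrM mulfV ?powRr1 // pnatr_eq0 -lt0n.
apply: ge0_ler_powR; rewrite ?invr_ge0 ?nnegrE ?opnorm_ge0 ?exprn_ge0 //.
exact: Ht.
Qed.

Let u_ge0 H k : 0 <= u H k.
Proof.
rewrite /u; set S := (X in sup X).
have [->|/set0P S0] := eqVneq S set0; first by rewrite sup0.
have [hu|/sup_out -> //] := pselect (has_sup S).
case: (S0) => y Sy; rewrite (@le_trans _ _ y) //.
  by case: Sy => M _ <-; exact: powR_ge0.
by apply: ub_le_sup => //; case: hu.
Qed.

(* Fekete's argument: by submultiplicativity the sequence converges to its
   infimum, so [jsr] is an actual limit. *)
Lemma jsr_inf H (c : R) : H !=set0 -> 1 <= c ->
  (forall A, H A -> opnorm A <= c) ->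
  jsr H = inf [set u H k | k in [set k | (0 < k)%N]].
Proof.
move=> H0 c1 Hc; set S := (X in inf X).
have Slb : has_lbound S by exists 0 => _ [k _ <-].
have Sinf : has_inf S by split => //; exists (u H 1), 1%N.
apply/cvg_lim => //; apply/cvgrPdist_le => e e0.
have e2 : 0 < e / 2 by rewrite divr_gt0.
have [_ [m m0 <-] um] := inf_adherent e2 Sinf.
set r := inf S in um *.
have r0 : 0 <= r by apply: lb_le_inf; [case: Sinf | move=> _ [k _ <-]].
(* The [m]-th term lies below [t], so products of any length [n] are bounded by [C * t ^+ n]. *)
pose t := r + e / 2.
have t0 : 0 < t by rewrite ltr_wpDl.
have [] := @mxprod_power_bound H c t m c1 Hc t0 m0.
  move=> M HM; rewrite (le_trans (u_ubound c1 Hc m0 HM)) //.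
  by rewrite lerXn2r ?nnegrE ?(ltW t0) // ltW.
move=> C C0 HC.
(* Chosen so that [(1 + q) * t = r + e]. Bernoulli's inequality gives [C <= (1 + q) ^+ n] for large
   [n], which absorbs the constant without taking its root. *)
pose q := e / 2 / t.
have q0 : 0 < q by rewrite divr_gt0.
have bern n : 1 + n%:R * q <= (1 + q) ^+ n.
  elim: n => [|n IH]; first by rewrite mul0r addr0 expr0.
  rewrite exprS -natr1.
  have n0 : 0 <= n%:R * q by rewrite mulr_ge0 // ltW.
  rewrite (le_trans _ (ler_wpM2l _ IH)) ?addr_ge0 ?(ltW q0) //.
  by rewrite mulrDl mul1r; nra.
near=> n.
have n0 : (0 < n)%N by near: n; exists 1%N.
have rn : r <= u H n by apply: ge_inf => //; exists n.
have un : u H n <= r + e.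
  apply: u_le => // [|M HM]; first by rewrite addr_ge0 // ltW.
  rewrite (le_trans (HC _ _ HM)) //.
  have -> : r + e = (1 + q) * t.
    by rewrite mulrDl mul1r divfK ?gt_eqF // /t -addrA -splitr.
  rewrite exprMn ler_wpM2r ?exprn_ge0 ?(ltW t0) // (le_trans _ (bern n)) //.
  rewrite (@le_trans _ _ (n%:R * q)) ?lerDr // -ler_pdivrMr //.
  near: n; exact: nbhs_infty_ger.
by rewrite distrC ger0_norm ?subr_ge0 // lerBlDl.
Unshelve. all: by end_near.
Qed.

(** As [jsr] is an infimum of nonnegative terms, [beta] is positive and some term already lies below
    it; that term provides the block length. *)
Lemma jsr_growth H (c beta : R) : H !=set0 -> 1 <= c ->
  (forall A, H A -> opnorm A <= c) -> jsr H < beta ->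
  0 < beta /\ exists2 C : R, 0 <= C &
    forall l M, seqs_in H l M -> opnorm (mxprod M l) <= C * beta ^+ l.
Proof.
move=> H0 c1 Hc; rewrite (jsr_inf H0 c1 Hc); set S := (X in inf X) => rb.
have Sinf : has_inf S by split; [exists (u H 1), 1%N | exists 0 => _ [k _ <-]].
have r0 : 0 <= inf S by apply: lb_le_inf; [case: Sinf | move=> _ [k _ <-]].
have b0 : 0 < beta by rewrite (le_lt_trans r0).
split => //.
have e0 : 0 < beta - inf S by rewrite subr_gt0.
have [_ [m m0 <-]] := inf_adherent e0 Sinf; rewrite subrKC => um.
apply: (@mxprod_power_bound H c beta m) => // M HM.
rewrite (le_trans (u_ubound c1 Hc m0 HM)) //.
by rewrite lerXn2r ?nnegrE // ltW.
Qed.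

(** * Passage from a set of matrices to its convex hull *)

Lemma convex_hull_sub H A : H A -> convex_hull H A.
Proof. by move=> HA C [_ HC]; exact: HC. Qed.

Lemma convex_hull_conv H (A B : 'M[R]_N) (t : R) : 0 <= t <= 1 ->
  convex_hull H A -> convex_hull H B ->
  convex_hull H (t *: A + (1 - t) *: B).
Proof.
move=> t01 HA HB C [Ccvx HC].
have tE : t \in `[0, 1] by rewrite in_itv.
have /mem_set AC : C A by exact: HA.
have /mem_set BC : C B by exact: HB.
have := Ccvx A B (Itv01 (andP t01).1 (andP t01).2) AC BC.
by rewrite inE.
Qed.

(** The matrices [Z] with [opnorm (A *m Z *m B) <= c] form a convex set, by linearity in [Z], and
    the hull is the smallest convex set containing [H]. The outer factors allow one factor of a
    product to be exchanged. *)
Lemma convex_hull_opnorm H (A B : 'M[R]_N) (c : R) : 0 <= c ->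
  (forall Y, H Y -> opnorm (A *m Y *m B) <= c) ->
  forall Y, convex_hull H Y -> opnorm (A *m Y *m B) <= c.
Proof.
move=> c0 Hc Y.
suff Ccvx : @convex_set R 'M[R]_N [set Z | opnorm (A *m Z *m B) <= c].
  by move=> HY; exact: (HY [set Z | opnorm (A *m Z *m B) <= c]).
move=> Z1 Z2 t; rewrite !inE /= => h1 h2.
have -> : conv t Z1 Z2
    = t%:num *: (Z1 : 'M[R]_N) + (1 - t%:num) *: (Z2 : 'M[R]_N) by [].
apply: opnorm_le => // x.
have t0 : 0 <= t%:num by [].
have t1 : 0 <= 1 - t%:num by rewrite subr_ge0.
rewrite mulmxDr !mulmxDl -!scalemxAr -!scalemxAl.
rewrite (le_trans (ler_normD _ _)) // !normrZ !ger0_norm //.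
have B1 := le_trans (opnormP _ x) (ler_wpM2r (normr_ge0 x) h1).
have B2 := le_trans (opnormP _ x) (ler_wpM2r (normr_ge0 x) h2).
have := lerD (ler_wpM2l t0 B1) (ler_wpM2l t1 B2).
by rewrite -mulrDl subrKC mul1r.
Qed.

Lemma convex_hull_mxprod H l (c : R) : 0 <= c ->
  (forall M, seqs_in H l M -> opnorm (mxprod M l) <= c) ->
  forall M, seqs_in (convex_hull H) l M -> opnorm (mxprod M l) <= c.
Proof.
move=> c0.
(* The prefix [A] collects the leftmost factors already taken from the hull, while the factors to
   its right still range over [H]. *)
suff G : forall A : 'M[R]_N,
    (forall M, seqs_in H l M -> opnorm (A *m mxprod M l) <= c) ->
    forall M, seqs_in (convex_hull H) l M -> opnorm (A *m mxprod M l) <= c.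
  move=> Hc M HM; rewrite -[mxprod M l]mul1mx.
  by apply: G => // M' HM'; rewrite mul1mx; exact: Hc.
elim: l => [|l IH] A Hc M HM /=; first exact: (Hc M).
rewrite mulmxA; apply: IH => [M' HM'|i il]; last first.
  by apply: HM; rewrite ltnS ltnW.
have HMl : convex_hull H (M l) by exact: HM.
suff P Y : H Y -> opnorm (A *m Y *m mxprod M' l) <= c.
  exact: (convex_hull_opnorm c0 P HMl).
move=> HY.
pose M'' i := if i == l then Y else M' i.
have -> : A *m Y *m mxprod M' l = A *m mxprod M'' l.+1.
  rewrite /= {1}/M'' eqxx mulmxA (@eq_mxprod M' M'') // => i il.
  by rewrite /M'' (ltn_eqF il).
apply: Hc => i; rewrite ltnS leq_eqVlt /M''; case: eqP => //= _ il.
exact: HM'.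
Qed.

Lemma growth_constP H (c beta : R) : H !=set0 -> 1 <= c ->
  (forall A, H A -> opnorm A <= c) -> jsr H < beta ->
  forall l M, seqs_in (convex_hull H) l M ->
  opnorm (mxprod M l) <= growth_const H beta * beta ^+ l.
Proof.
move=> H0 c1 Hc rb; have [b0 [C C0 HC]] := jsr_growth H0 c1 Hc rb.
have bl l : 0 < beta ^+ l by rewrite exprn_gt0.
have hullC l M : seqs_in (convex_hull H) l M ->
    opnorm (mxprod M l) <= C * beta ^+ l.
  by apply: convex_hull_mxprod; [rewrite mulr_ge0 // ltW | exact: HC].
move=> l M HM; rewrite -ler_pdivrMr //.
have ubl k : has_ubound [set opnorm (mxprod M' k)
    | M' in seqs_in (convex_hull H) k].
  by exists (C * beta ^+ k) => _ [M' HM' <-]; exact: hullC.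
rewrite (@le_trans _ _ (beta ^- l * sup [set opnorm (mxprod M' l)
    | M' in seqs_in (convex_hull H) l])) //.
  rewrite mulrC ler_wpM2l ?invr_ge0 ?(ltW (bl _)) //.
  by apply: ub_le_sup => //; exists M.
apply: ub_le_sup; last by exists l.
(* Each weighted supremum is at most [C], so the outer supremum is finite and does bound its
   terms. *)
exists C => _ [k _ <-]; rewrite mulrC ler_pdivrMr //.
apply: ge_sup; last by move=> _ [M' HM' <-]; exact: hullC.
case: H0 => A HA; exists (opnorm (mxprod (fun=> A) k)), (fun=> A) => //.
by move=> i _; exact: convex_hull_sub.
Qed.

End JointSpectralRadius.

(** * Expectations over finitely many independent draws *)

Section FiniteExpectation.
Context {R : realType} {O : finType}.
Variable q : O -> R.
Hypotheses (q_ge0 : forall o, 0 <= q o) (q_sum1 : \sum_o q o = 1).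
Implicit Types (f g : seq O -> R) (c : R).

(** The head of the list is the newest draw and is averaged first, with the past held fixed; an
    induction on [k] thus conditions on the past. *)
Fixpoint Ex (k : nat) f : R :=
  if k is k'.+1 then Ex k' (fun h => \sum_o q o * f (o :: h)) else f [::].

Lemma Ex_le k f g : (forall h, size h = k -> f h <= g h) -> Ex k f <= Ex k g.
Proof.
elim: k f g => [|k IH] f g fg /=; first exact: fg.
apply: IH => h hk; apply: ler_sum => o _; rewrite ler_wpM2l //.
by apply: fg; rewrite /= hk.
Qed.

Lemma eq_Ex k f g : f =1 g -> Ex k f = Ex k g.
Proof. by move=> fg; congr Ex; exact/funext. Qed.

Lemma ExD k f g : Ex k (fun h => f h + g h) = Ex k f + Ex k g.
Proof.
elim: k f g => //= k IH f g; rewrite -IH; apply: eq_Ex => h.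
by rewrite -big_split; apply: eq_bigr => o _; rewrite mulrDr.
Qed.

Lemma ExZ k c f : Ex k (fun h => c * f h) = c * Ex k f.
Proof.
elim: k f => //= k IH f; rewrite -IH; apply: eq_Ex => h.
by rewrite mulr_sumr; apply: eq_bigr => o _; rewrite mulrCA.
Qed.

Lemma Ex_cst k c : Ex k (fun=> c) = c.
Proof.
elim: k => //= k IH; rewrite -[RHS]IH; apply: eq_Ex => h.
by rewrite -mulr_suml q_sum1 mul1r.
Qed.

Lemma Ex_sum k (I : finType) (f : I -> seq O -> R) :
  Ex k (fun h => \sum_i f i h) = \sum_i Ex k (f i).
Proof.
elim: k f => //= k IH f; rewrite -IH; apply: eq_Ex => h.
by rewrite exchange_big /=; apply: eq_bigr => o _; rewrite mulr_sumr.
Qed.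

Lemma Ex_ge0 k f : (forall h, 0 <= f h) -> 0 <= Ex k f.
Proof. by move=> f0; rewrite -(Ex_cst k 0); apply: Ex_le. Qed.

(** Jensen's inequality, obtained from the nonnegative variance of [|f|]. *)
Lemma Ex_abs_le_sqrt k f c : Ex k (fun h => f h ^+ 2) <= c ->
  Ex k (fun h => `|f h|) <= Num.sqrt c.
Proof.
move=> fc; set m := Ex k (fun h => `|f h|).
have m0 : 0 <= m by apply: Ex_ge0.
have : 0 <= Ex k (fun h => (`|f h| - m) ^+ 2).
  by apply: Ex_ge0 => h; exact: sqr_ge0.
rewrite (@eq_Ex _ _ (fun h => f h ^+ 2 + ((- 2 * m) * `|f h| + m ^+ 2))).
  rewrite !ExD ExZ Ex_cst -/m => H.
  by rewrite -(ger0_norm m0) -sqrtr_sqr ler_wsqrtr //; nra.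
by move=> h; rewrite -[f h ^+ 2]real_normK ?num_real //; ring.
Qed.

Lemma Ex_tuple k f :
  Ex k f = \sum_(t : k.-tuple O) (\prod_(o <- t) q o) * f t.
Proof.
elim: k f => [|k IH] f /=.
  rewrite (big_pred1 [tuple]) => [|t]; last first.
    by apply/esym/eqP; exact: tuple0.
  by rewrite big_nil mul1r.
rewrite IH (reindex (fun x : k.-tuple O * O => [tuple of x.2 :: x.1])) /=.
  rewrite -(pair_bigA _ (fun (t : k.-tuple O) o =>
     (\prod_(o' <- o :: t) q o') * f (o :: t))) /=.
  apply: eq_bigr => t _; rewrite mulr_sumr; apply: eq_bigr => o _.
  by rewrite big_cons; ring.
exists (fun t : k.+1.-tuple O => ([tuple of behead t] : k.-tuple O, thead t))
  => [[t o]|t] _.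
  by congr (_, _); apply: val_inj.
by rewrite [RHS]tuple_eta; apply: val_inj.
Qed.

End FiniteExpectation.

(** * The law of the observed history *)

Section History.
Context {R : realType} {nS nA : nat}.
Local Notation state := 'I_nS.+1.
Local Notation action := 'I_nA.+1.
Local Notation obs := (state * action * state)%type.
Variables (X : mdp R nS nA) (d : state -> action -> R).
Context {disp : measure_display} {Omega : measurableType disp}.
Variable Pr : probability Omega R.
Variables (s : nat -> Omega -> state) (a : nat -> Omega -> action)
          (s' : nat -> Omega -> state).
Hypothesis hobs : iid_observations Pr s a s' X d.

Definition obs_prob (o : obs) : R :=
  d o.1.1 o.1.2 * trans X o.1.1 o.1.2 o.2.

(* Most recent observation first. *)
Fixpoint history (w : Omega) (k : nat) : seq obs :=
  if k is j.+1 then (s j w, a j w, s' j w) :: history w j else [::].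

(** Translates a list into an event [past], the form in which the hypotheses on the observations are
    stated. *)
Lemma history_past (l : seq obs) : exists h,
  past s a s' (size l) h = [set w | history w (size l) = l].
Proof.
elim: l => [|o l [h IH]].
  by exists (fun=> (ord0, ord0, ord0)); apply/seteqP; split.
exists (fun i => if i == size l then o else h i).
have eqIH w : past s a s' (size l) h w <-> history w (size l) = l.
  by rewrite IH.
apply/seteqP; split => w /=.
  move=> H; congr (_ :: _); first by rewrite (H (size l)) ?eqxx.
  by apply/eqIH => i il; rewrite (H i) ?(ltn_eqF il) // ltnS ltnW.
move=> [<- /eqIH H] i; rewrite ltnS leq_eqVlt; case: eqP => [-> //|_ /= il].
exact: H.
Qed.

Lemma history_step (o : obs) (l : seq obs) :
  [set w | history w (size l).+1 = o :: l] =
  [set w | history w (size l) = l]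
    `&` [set w | s (size l) w = o.1.1 /\ a (size l) w = o.1.2]
    `&` [set w | s' (size l) w = o.2].
Proof.
case: o => [[x u] y]; apply/seteqP; split => w /=.
  by case=> e1 e2 e3 e4; split=> //; split=> //; split.
by case=> -[-> [-> ->]] ->.
Qed.

Lemma measurable_history (l : seq obs) :
  measurable [set w | history w (size l) = l].
Proof.
elim: l => [|o l IH] /=.
  by rewrite (_ : [set w | _] = setT) //; apply/seteqP; split.
rewrite -[[set w | _]]/[set w | history w (size l).+1 = o :: l] history_step.
apply: measurableI; last exact: (obs_meas_s' hobs).
apply: measurableI => //; apply: (@measurableI _ _ [set w | _] [set w | _]).
  exact: (obs_meas_s hobs).
exact: (obs_meas_a hobs).
Qed.

(** Chain rule: the newest observation contributes the transition probability, then independence of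
    the past splits off [d]. *)
Lemma history_prob (l : seq obs) :
  Pr [set w | history w (size l) = l] = (\prod_(o <- l) obs_prob o)%:E.
Proof.
elim: l => [|o l IH].
  rewrite big_nil (_ : [set w | _] = setT); first exact: probability_setT.
  by apply/seteqP; split.
rewrite [LHS]/= -[[set w | _]]/[set w | history w (size l).+1 = o :: l].
rewrite history_step big_cons.
have [h hE] := history_past l.
rewrite -hE (obs_next hobs) (obs_indep hobs) (obs_law hobs) hE IH.
by rewrite -!EFinM; congr _%:E; rewrite /obs_prob; ring.
Qed.

Lemma expectation_history k (f : seq obs -> R) : (forall h, 0 <= f h) ->
  ('E_Pr[(fun w => f (history w k))] = (Ex obs_prob k f)%:E)%E.
Proof.
move=> f0; rewrite unlock.
have szh w j : size (history w j) = j by elim: j => //= j ->.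
pose E (t : k.-tuple obs) := [set w | history w k = t].
have mE t : measurable (E t).
  by have := measurable_history t; rewrite size_tuple.
(* The integrand takes one value on each of the finitely many history events, hence is a finite
   combination of indicators. *)
transitivity (\int[Pr]_w (\sum_(t : k.-tuple obs) (f t * \1_(E t) w)%:E))%E.
  apply: eq_integral => w _; rewrite sumEFin; congr _%:E.
  pose t0 := tcast (szh w k) (in_tuple (history w k)).
  have t0E : t0 = history w k :> seq obs by rewrite val_tcast.
  rewrite (bigD1 t0) //= big1 ?addr0 => [|t tt0].
    by rewrite indicE mem_set ?mulr1 ?t0E.
  rewrite indicE memNset ?mulr0 // /E /= => ht.
  by case/eqP: tt0; apply: val_inj; rewrite /= t0E.
rewrite ge0_integral_sum // => [|t|t w _]; first last.
- by rewrite lee_fin mulr_ge0.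
- by apply/measurable_EFinP; apply: measurable_funM.
rewrite Ex_tuple -sumEFin; apply: eq_bigr => t _.
rewrite (integralZl_indic measurableT (fun=> E t)) //; last first.
  by move=> ft0; have := f0 t; rewrite leNgt ft0.
rewrite integral_indic // setIT.
have := history_prob t; rewrite size_tuple -/(E t) => Pt.
apply: (etrans (congr1 (mule (f t)%:E) Pt)).
by rewrite -EFinM mulrC.
Qed.

End History.

(** * The expected Q-learning step as a switched linear system *)

Section SwitchingSystem.
Context {R : realType} {nS nA : nat}.
Local Notation state := 'I_nS.+1.
Local Notation action := 'I_nA.+1.
Local Notation obs := (state * action * state)%type.
Local Notation N := (nS.+1 * nA.+1)%N.
Local Notation qfun := 'cV[R]_N.
Variables (X : mdp R nS nA) (d : state -> action -> R) (alpha : R).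
Hypotheses (d_gt0 : forall s a, 0 < d s a).
Hypotheses (alpha_gt0 : 0 < alpha) (alpha_lt1 : alpha < 1).
Hypothesis d_sum1 : \sum_s \sum_a d s a = 1.
Implicit Types (Q x : qfun) (mu : state -> action -> R).

Local Notation gamma := (disc X).
Local Notation rho := (1 - alpha * (dmin d * (1 - gamma))).

Let gamma_ge0 : 0 <= gamma. Proof. exact/ltW/disc_gt0. Qed.
Let gamma_le1 : gamma <= 1. Proof. exact/ltW/disc_lt1. Qed.
Let alpha_ge0 : 0 <= alpha. Proof. exact: ltW. Qed.
Let d_ge0 s a : 0 <= d s a. Proof. exact/ltW. Qed.

Lemma dmin_le s a : dmin d <= d s a.
Proof. exact: (bigmin_le _ (s, a) (fun sa : state * action => d sa.1 sa.2)). Qed.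

Lemma dmax_ge s a : d s a <= dmax d.
Proof. exact: (le_bigmax _ (fun sa : state * action => d sa.1 sa.2) (s, a)). Qed.

Lemma dmin_gt0 : 0 < dmin d.
Proof.
by apply: (big_ind (fun y => 0 < y)) => // x y x0 y0; rewrite lt_min x0.
Qed.

Let d_le1 s a : d s a <= 1.
Proof.
rewrite -d_sum1 (bigD1 s) //= (bigD1 a) //= -addrA lerDl.
by rewrite addr_ge0 // sumr_ge0 // => t _; rewrite sumr_ge0.
Qed.

Lemma qvalD Q1 Q2 s a : qval (Q1 + Q2) s a = qval Q1 s a + qval Q2 s a.
Proof. by rewrite /qval mxE. Qed.

Lemma qvalB Q1 Q2 s a : qval (Q1 - Q2) s a = qval Q1 s a - qval Q2 s a.
Proof. by rewrite /qval !mxE. Qed.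

Lemma qvalZ (c : R) Q s a : qval (c *: Q) s a = c * qval Q s a.
Proof. by rewrite /qval mxE. Qed.

Lemma qval_le Q s a : `|qval Q s a| <= `|Q|.
Proof. exact: cv_coord_le. Qed.

Lemma qvec_norm_le Q (c : R) :
  0 <= c -> (forall s a, `|qval Q s a| <= c) -> `|Q| <= c.
Proof.
by move=> c0 Qc; apply: cv_norm_le => // i; case/mxvec_indexP: i => s a; exact: Qc.
Qed.

Lemma distr_sum_le (I : finType) (p y : I -> R) (c : R) :
  is_distr p -> (forall i, `|y i| <= c) -> `|\sum_i p i * y i| <= c.
Proof.
move=> [p0 p1] yc; rewrite (le_trans (ler_norm_sum _ _ _)) //.
rewrite -[leRHS]mul1r -p1 mulr_suml; apply: ler_sum => i _.
by rewrite normrM ger0_norm // ler_wpM2l.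
Qed.

Lemma trans_distr s a : is_distr (trans X s a).
Proof. by split; [exact: trans_ge0 | exact: trans_sum1]. Qed.

Lemma Vmax_ge Q s a : qval Q s a <= Vmax Q s.
Proof. exact: (le_bigmax _ (qval Q s)). Qed.

Lemma Vmax_attained Q : exists pi, forall s, Vmax Q s = qval Q s (pi s).
Proof.
suff /choice[pi] : forall s, exists a, Vmax Q s = qval Q s a by exists pi.
move=> s; apply: (big_ind (fun y => exists a, y = qval Q s a)).
- by exists ord0.
- by move=> y z [a ->] [b ->]; case: (leP (qval Q s a)); [exists b|exists a].
- by move=> a _; exists a.
Qed.

Lemma Vmax_norm_le Q s : `|Vmax Q s| <= `|Q|.
Proof. by have [pi ->] := Vmax_attained Q; exact: qval_le. Qed.

Lemma DmxE x s a : qval (Dmx d *m x) s a = d s a * qval x s a.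
Proof.
by rewrite /qval /Dmx mul_diag_mx !mxE -[X in _ = X * _](qvalK d) /qval mxE.
Qed.

Lemma PmxvE (v : 'cV[R]_nS.+1) s a :
  qval (Pmx X *m v) s a = \sum_t trans X s a t * v t 0.
Proof. by rewrite /qval mxE; apply: eq_bigr => t _; rewrite PmxE. Qed.

Lemma bellmanE Q s a : qval (bellman X Q) s a =
  \sum_t trans X s a t * reward X s a t
  + gamma * \sum_t trans X s a t * Vmax Q t.
Proof.
rewrite /bellman qvalD qvalK qvalZ PmxvE; congr (_ + _ * _).
by apply: eq_bigr => t _; rewrite mxE.
Qed.

(** Extends [Mpi] to stochastic policies; on [onehot pi] the two agree by definition. *)
Definition Mmx mu : 'M[R]_N :=
  1%:M - alpha *: Dmx d + (alpha * gamma) *: (Dmx d *m Pmx X *m Pimx mu).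

Lemma MmxE mu x s a : qval (Mmx mu *m x) s a =
  (1 - alpha * d s a) * qval x s a
  + alpha * gamma * d s a
    * \sum_t trans X s a t * \sum_u mu t u * qval x t u.
Proof.
rewrite /Mmx mulmxDl mulmxBl mul1mx -!scalemxAl -!mulmxA.
rewrite qvalD qvalB !qvalZ !DmxE PmxvE.
under eq_bigr do rewrite PimxE.
by ring.
Qed.

(** All coefficients are nonnegative because [alpha * d s a <= 1], and row [(s, a)] sums to
    [1 - alpha * d s a * (1 - gamma)], which is largest where [d] is smallest. *)
Lemma Mmx_norm_le mu x :
  (forall s, is_distr (mu s)) -> `|Mmx mu *m x| <= rho * `|x|.
Proof.
move=> hmu.
have dg s a : 0 <= alpha * d s a <= 1.
  by rewrite mulr_ge0 //= mulr_ile1 // ltW.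
have dm s a : 1 - alpha * d s a + alpha * gamma * d s a <= rho.
  have -> : 1 - alpha * d s a + alpha * gamma * d s a
    = 1 - alpha * (d s a * (1 - gamma)) by ring.
  by rewrite lerB // ler_wpM2l // ler_wpM2r ?subr_ge0 // dmin_le.
have sum0 s a : 0 <= 1 - alpha * d s a + alpha * gamma * d s a.
  by rewrite addr_ge0 ?subr_ge0 ?mulr_ge0 //; case/andP: (dg s a).
apply: qvec_norm_le => [|s a].
  by rewrite mulr_ge0 // (le_trans (sum0 ord0 ord0)).
rewrite (le_trans _ (ler_wpM2r (normr_ge0 x) (dm s a))) //.
rewrite MmxE (le_trans (ler_normD _ _)) // [leRHS]mulrDl !normrM.
rewrite [in leLHS](@ger0_norm _ (1 - _)); last first.
  by rewrite subr_ge0; case/andP: (dg s a).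
rewrite !(@ger0_norm _ alpha, @ger0_norm _ gamma, @ger0_norm _ (d _ _)) //.
apply: lerD; first by rewrite ler_wpM2l ?qval_le // subr_ge0; case/andP: (dg s a).
rewrite ler_wpM2l ?mulr_ge0 //; apply: distr_sum_le; first exact: trans_distr.
by move=> t; apply: distr_sum_le => // u; exact: qval_le.
Qed.

(** Only the policy terms survive in the difference. Each is an average of coordinates of [x],
    whence the factor 2. *)
Lemma Mmx_sub_norm_le mu nu x :
  (forall s, is_distr (mu s)) -> (forall s, is_distr (nu s)) ->
  `|(Mmx mu - Mmx nu) *m x| <= 2 * alpha * gamma * dmax d * `|x|.
Proof.
move=> hmu hnu.
have dmax0 : 0 <= dmax d by rewrite (le_trans _ (dmax_ge ord0 ord0)).
apply: qvec_norm_le => [|s a]; first by rewrite !mulr_ge0.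
have sub : qval ((Mmx mu - Mmx nu) *m x) s a
    = alpha * gamma * d s a *
      (\sum_t trans X s a t * (\sum_u mu t u * qval x t u)
       - \sum_t trans X s a t * (\sum_u nu t u * qval x t u)).
  by rewrite mulmxBl qvalB !MmxE; ring.
have bnd m : (forall s, is_distr (m s)) ->
    `|\sum_t trans X s a t * (\sum_u m t u * qval x t u)| <= `|x|.
  move=> hm; apply: distr_sum_le => [|t]; first exact: trans_distr.
  by apply: distr_sum_le => // u; exact: qval_le.
rewrite sub !normrM (@ger0_norm _ alpha) // (@ger0_norm _ gamma) //.
rewrite (@ger0_norm _ (d s a)) //.
have -> : 2 * alpha * gamma * dmax d * `|x|
    = alpha * gamma * dmax d * (`|x| + `|x|) by ring.
rewrite ler_pM ?mulr_ge0 //; first by rewrite ler_wpM2l ?mulr_ge0 // dmax_ge.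
by rewrite (le_trans (ler_normB _ _)) // lerD // bnd.
Qed.

Lemma Mmx_affine mu mu1 mu2 (t : R) :
  (forall s u, mu s u = t * mu1 s u + (1 - t) * mu2 s u) ->
  Mmx mu = t *: Mmx mu1 + (1 - t) *: Mmx mu2.
Proof.
move=> muE.
have PiE : Pimx mu = t *: Pimx mu1 + (1 - t) *: Pimx mu2.
  have PimxvE m s s1 u :
      Pimx m s (mxvec_index s1 u) = if s1 == s then m s u else 0 :> R.
    by rewrite mxE -[LHS]/(qval (qvec _) s1 u) qvalK.
  apply/matrixP => s j; case/mxvec_indexP: j => s1 u.
  rewrite [RHS]mxE [X in X + _]mxE [X in _ + X]mxE !PimxvE.
  by case: (s1 == s); rewrite ?muE ?mulr0 ?addr0.
rewrite /Mmx PiE mulmxDr -!scalemxAr.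
move: (Dmx d *m Pmx X *m Pimx mu1) (Dmx d *m Pmx X *m Pimx mu2) => U V.
by apply/matrixP => i j; rewrite !mxE; ring.
Qed.

(** The weight varies with the state, since the comparison of two greedy policies yields a separate
    weight in each state. *)
Definition mixed (t : state -> R) (p1 p2 : state -> action) s a : R :=
  t s * onehot p1 s a + (1 - t s) * onehot p2 s a.

Lemma onehot_sum (pi : state -> action) s (f : action -> R) :
  \sum_u onehot pi s u * f u = f (pi s).
Proof.
rewrite (bigD1 (pi s)) //= big1 ?addr0 => [|u /negPf upi].
  by rewrite /onehot eqxx mul1r.
by rewrite /onehot upi mul0r.
Qed.

Lemma onehot_distr (pi : state -> action) s : is_distr (@onehot R _ _ pi s).
Proof.
split=> [u|]; first exact: ler0n.
by rewrite -[RHS](onehot_sum pi s (fun=> 1)); apply: eq_bigr => u _; rewrite mulr1.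
Qed.

Lemma mixed_sum t p1 p2 s (f : action -> R) :
  \sum_u mixed t p1 p2 s u * f u = t s * f (p1 s) + (1 - t s) * f (p2 s).
Proof.
rewrite -(onehot_sum p1 s f) -(onehot_sum p2 s f) !mulr_sumr -big_split /=.
by apply: eq_bigr => u _; rewrite /mixed; ring.
Qed.

Lemma mixed_distr t p1 p2 s :
  0 <= t s <= 1 -> is_distr (mixed t p1 p2 s).
Proof.
case/andP=> t0 t1; split=> [u|].
  by rewrite addr_ge0 // mulr_ge0 ?subr_ge0 // ler0n.
transitivity (\sum_u mixed t p1 p2 s u * 1).
  by apply: eq_bigr => u _; rewrite mulr1.
by rewrite mixed_sum !mulr1 subrKC.
Qed.

(* The policy is made deterministic one state at a time. *)
Lemma mixed_in_hull t p1 p2 : (forall s, 0 <= t s <= 1) ->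
  convex_hull (Mset X d alpha) (Mmx (mixed t p1 p2)).
Proof.
move=> t01.
(* Induction on [n], where the two policies may differ only at states below [n]. *)
suff G n : forall p1 p2 : state -> action,
    (forall s : state, (n <= s)%N -> p1 s = p2 s) ->
    convex_hull (Mset X d alpha) (Mmx (mixed t p1 p2)).
  apply: (G nS.+1) => s; by rewrite leqNgt ltn_ord.
elim: n => [|n IH] {}p1 {}p2 p12.
  apply: convex_hull_sub; exists p1 => //.
  have -> // : mixed t p1 p2 = onehot p1.
  apply/funext => s; apply/funext => u.
  by rewrite /mixed /onehot -(p12 s) // -mulrDl subrKC mul1r.
have [nS_n|n_nS] := leqP nS.+1 n.
  by apply: IH => s ns; have := leq_trans nS_n ns; rewrite leqNgt ltn_ord.
pose sn := Ordinal n_nS.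
pose upd (p p' : state -> action) s := if s == sn then p' s else p s.
(* Both new mixtures are deterministic at [sn], playing [p1 sn] and [p2 sn] respectively, and equal
   the old mixture elsewhere; hence weight [t sn] recombines them. *)
rewrite (@Mmx_affine _ (mixed t p1 (upd p2 p1)) (mixed t (upd p1 p2) p2) (t sn)).
  apply: convex_hull_conv => //; apply: IH => s; rewrite leq_eqVlt /upd.
    case: eqP => [ns _|_ /= ns]; first by rewrite -val_eqE /= -ns eqxx.
    by case: ifP => // _; exact: p12.
  case: eqP => [ns _|_ /= ns]; first by rewrite -val_eqE /= -ns eqxx.
  by case: ifP => // _; exact: p12.
by move=> s u; rewrite /mixed /onehot /upd; case: (eqVneq s sn) => [->|_]; ring.
Qed.

Lemma convex_comb_between (x y v : R) : y <= v -> v <= x ->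
  exists2 t, 0 <= t <= 1 & v = t * x + (1 - t) * y.
Proof.
move=> yv vx; have [xy|xy] := eqVneq x y.
  exists 0; first by rewrite lexx ler01.
  by rewrite mul0r add0r subr0 mul1r; apply/eqP; rewrite eq_le yv -xy vx.
have yx : 0 < x - y by rewrite subr_gt0 lt_def xy /= (le_trans yv).
exists ((v - y) / (x - y)).
  apply/andP; split; first by rewrite divr_ge0 ?(ltW yx) // subr_ge0.
  by rewrite ler_pdivrMr // mul1r lerD2r.
have -> : (v - y) / (x - y) * x + (1 - (v - y) / (x - y)) * y
    = (v - y) / (x - y) * (x - y) + y by ring.
by rewrite divfK ?gt_eqF // subrK.
Qed.

(* [Vmax Q - Vmax Qs] lies between the values of [Q - Qs] at the greedy actions
   of [Qs] and of [Q]. *)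
Lemma expected_update_switching Q Qs : bellman X Qs = Qs ->
  exists mu, [/\ forall s, is_distr (mu s),
    convex_hull (Mset X d alpha) (Mmx mu)
    & Q - Qs + alpha *: (Dmx d *m (bellman X Q - Q)) = Mmx mu *m (Q - Qs)].
Proof.
move=> fixQs.
have [p1 p1E] := Vmax_attained Q; have [p2 p2E] := Vmax_attained Qs.
have /choice[t tE] : forall s, exists t : R, 0 <= t <= 1 /\
    Vmax Q s - Vmax Qs s = t * qval (Q - Qs) s (p1 s)
      + (1 - t) * qval (Q - Qs) s (p2 s).
  move=> s.
  have [||t t01 tE] := @convex_comb_between (qval (Q - Qs) s (p1 s))
    (qval (Q - Qs) s (p2 s)) (Vmax Q s - Vmax Qs s).
  - by rewrite qvalB -p2E lerD2r Vmax_ge.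
  - by rewrite qvalB -p1E lerD2l lerN2 Vmax_ge.
  by exists t.
have t01 s : 0 <= t s <= 1 by have [] := tE s.
exists (mixed t p1 p2); split.
- by move=> s; exact: mixed_distr.
- exact: mixed_in_hull.
apply/matrixP => i j; rewrite (ord1 j); case/mxvec_indexP: i => s a.
rewrite -!/(qval _ s a) MmxE.
under [X in _ = _ + _ * X]eq_bigr do
  rewrite mixed_sum -(proj2 (tE _)) mulrBr.
rewrite sumrB.
(* The fixed-point equation of [Qs] cancels the expected reward. *)
have := bellmanE Qs s a; rewrite fixQs => QsE.
rewrite qvalD !qvalB qvalZ DmxE qvalB bellmanE QsE.
by ring.
Qed.

End SwitchingSystem.

(** * The stochastic recursion and its noise *)

Section QLearningRecursion.
Context {R : realType} {nS nA : nat}.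
Local Notation state := 'I_nS.+1.
Local Notation action := 'I_nA.+1.
Local Notation obs := (state * action * state)%type.
Local Notation N := (nS.+1 * nA.+1)%N.
Local Notation qfun := 'cV[R]_N.
Variables (X : mdp R nS nA) (d : state -> action -> R) (alpha : R).
Hypotheses (d_gt0 : forall s a, 0 < d s a).
Hypotheses (alpha_gt0 : 0 < alpha) (alpha_lt1 : alpha < 1).
Hypothesis d_sum1 : \sum_s \sum_a d s a = 1.
Implicit Types (Q : qfun) (o : obs) (h : seq obs).

Local Notation gamma := (disc X).
Local Notation rho := (1 - alpha * (dmin d * (1 - gamma))).
Local Notation q := (obs_prob X d).
Local Notation E := (Ex q).

Let gamma_ge0 : 0 <= gamma. Proof. exact/ltW/disc_gt0. Qed.
Let gamma_lt1 : gamma < 1. Proof. exact: disc_lt1. Qed.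
Let alpha_ge0 : 0 <= alpha. Proof. exact: ltW. Qed.
Let g1_gt0 : 0 < 1 - gamma. Proof. by rewrite subr_gt0. Qed.
Let dg_gt0 : 0 < dmin d * (1 - gamma).
Proof. by rewrite mulr_gt0 // dmin_gt0. Qed.
Let dmax_ge0 : 0 <= dmax d.
Proof. by rewrite (le_trans _ (dmax_ge d ord0 ord0)) // ltW. Qed.

Let q_ge0 o : 0 <= q o.
Proof. by rewrite mulr_ge0 ?trans_ge0 // ltW. Qed.

Lemma sum_obs (F : obs -> R) : \sum_o F o = \sum_s \sum_a \sum_t F (s, a, t).
Proof. by rewrite pair_bigA pair_bigA; apply: eq_bigr => -[[s a] t] _. Qed.

Let q_sum1 : \sum_o q o = 1.
Proof.
rewrite sum_obs -d_sum1; apply: eq_bigr => s _; apply: eq_bigr => a _.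
by rewrite -[RHS]mulr1 -(trans_sum1 X s a) mulr_sumr.
Qed.

Definition step o Q := q_update X alpha o.1.1 o.1.2 o.2 Q.

(** A martingale difference: the sampled increment minus its mean given the past. *)
Definition noise o Q : qfun :=
  step o Q - Q - alpha *: (Dmx d *m (bellman X Q - Q)).

Definition tderr Q (s : state) (a : action) (t : state) : R :=
  reward X s a t + gamma * Vmax Q t - qval Q s a.

Definition jump Q (s : state) (a : action) o : R :=
  if (s == o.1.1) && (a == o.1.2) then alpha * tderr Q s a o.2 else 0.

Lemma step_jump o Q s a : qval (step o Q - Q) s a = jump Q s a o.
Proof.
rewrite qvalB /step /q_update qvalK /jump.
case: ifP => [/andP[/eqP -> /eqP ->]|_]; last by rewrite subrr.
by rewrite addrC addKr.
Qed.

Lemma jump_mean Q s a :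
  \sum_o q o * jump Q s a o
  = qval (alpha *: (Dmx d *m (bellman X Q - Q))) s a.
Proof.
rewrite sum_obs (bigD1 s) //= (bigD1 a) //=.
rewrite [X in _ + X + _]big1 => [|u us]; last first.
  by apply: big1 => t _; rewrite /jump /= eqxx [a == u]eq_sym (negPf us) mulr0.
rewrite [X in _ + X]big1 => [|x xs]; last first.
  apply: big1 => u _; apply: big1 => t _.
  by rewrite /jump /= [s == x]eq_sym (negPf xs) mulr0.
rewrite !addr0 qvalZ DmxE qvalB bellmanE.
transitivity (\sum_t (alpha * d s a *
    (trans X s a t * reward X s a t + gamma * (trans X s a t * Vmax Q t)
     - trans X s a t * qval Q s a))).
  by apply: eq_bigr => t _; rewrite /jump /= !eqxx /= /obs_prob /tderr /=; ring.
rewrite -mulr_sumr sumrB big_split /= -mulr_sumr -mulr_suml trans_sum1; ring.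
Qed.

Lemma noiseE o Q s a : qval (noise o Q) s a
  = jump Q s a o - \sum_o' q o' * jump Q s a o'.
Proof. by rewrite /noise qvalB step_jump jump_mean. Qed.

Lemma noise_mean Q i : \sum_o q o * noise o Q i 0 = 0.
Proof.
case/mxvec_indexP: i => s a.
under eq_bigr do rewrite -[noise _ _ _ _]/(qval _ s a) noiseE mulrBr.
by rewrite sumrB -[X in _ - X]mulr_suml q_sum1 mul1r subrr.
Qed.

(** Centring only lowers the second moment, and a jump is at most [alpha * w] in absolute value. *)
Lemma noise_square Q (w : R) i :
  (forall s a t, `|tderr Q s a t| <= w) ->
  \sum_o q o * noise o Q i 0 ^+ 2 <= alpha ^+ 2 * w ^+ 2.
Proof.
move=> tdw; case/mxvec_indexP: i => s a.
have w0 : 0 <= w by rewrite (le_trans _ (tdw ord0 ord0 ord0)).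
set m := \sum_o q o * jump Q s a o.
have -> : \sum_o q o * noise o Q (mxvec_index s a) 0 ^+ 2
    = \sum_o q o * jump Q s a o ^+ 2 - m ^+ 2.
  transitivity (\sum_o (q o * jump Q s a o ^+ 2
      + ((- 2 * m) * (q o * jump Q s a o) + m ^+ 2 * q o))).
    apply: eq_bigr => o _.
    by rewrite -[noise _ _ _ _]/(qval _ s a) noiseE -/m; ring.
  by rewrite !big_split /= -!mulr_sumr -/m q_sum1; ring.
rewrite lerBlDr (@le_trans _ _ (alpha ^+ 2 * w ^+ 2)) ?lerDl ?sqr_ge0 //.
rewrite -[leRHS]mul1r -q_sum1 mulr_suml; apply: ler_sum => o _.
rewrite ler_wpM2l // /jump; case: ifP => _; last first.
  by rewrite expr0n mulr_ge0 ?sqr_ge0.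
rewrite exprMn ler_wpM2l ?sqr_ge0 // -real_normK ?num_real //.
by rewrite lerXn2r ?nnegrE.
Qed.

Variables (Q0 Qs : qfun).

Local Notation e0 := (Q0 - Qs).
Local Notation Qmax := (Num.max `|Q0| (Rmax X / (1 - gamma))).

Fixpoint iterate h : qfun := if h is o :: h' then step o (iterate h') else Q0.

Lemma iterate_history (disp : measure_display) (Omega : measurableType disp)
    (s : nat -> Omega -> state)
    (a : nat -> Omega -> action) (s' : nat -> Omega -> state) k w :
  q_iter X alpha Q0 (s ^~ w) (a ^~ w) (s' ^~ w) k = iterate (history s a s' w k).
Proof. by elim: k => //= k ->. Qed.

Lemma reward_le s a t : `|reward X s a t| <= Rmax X.
Proof.
exact: (le_bigmax _ (fun t : obs => `|reward X t.1.1 t.1.2 t.2|) (s, a, t)).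
Qed.

(** An updated coordinate is a convex combination of its old value and a target of size at most
    [Rmax X + gamma * Qmax], which is at most [Qmax] because [Qmax] dominates
    [Rmax X / (1 - gamma)]. *)
Lemma iterate_norm_le h : `|iterate h| <= Qmax.
Proof.
elim: h => [|[[s a] t] h IH] /=; first by rewrite le_max lexx.
have Qmax0 : 0 <= Qmax by rewrite le_max normr_ge0.
have RQ : Rmax X <= (1 - gamma) * Qmax.
  by rewrite mulrC -ler_pdivrMr // le_max lexx orbT.
apply: qvec_norm_le => // x u; rewrite /step /q_update /= qvalK.
case: ifP => _; last by rewrite (le_trans (qval_le _ _ _)).
set Qv := qval _ _ _; set V := Vmax _ _; set r := reward _ _ _ _.
have -> : Qv + alpha * (r + gamma * V - Qv)
    = (1 - alpha) * Qv + alpha * (r + gamma * V) by ring.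
have QvQ : `|Qv| <= Qmax by rewrite (le_trans (qval_le _ _ _)).
have VQ : `|V| <= Qmax by rewrite (le_trans (Vmax_norm_le _ _)).
have rV : `|r + gamma * V| <= Qmax.
  rewrite (le_trans (ler_normD _ _)) // normrM (ger0_norm gamma_ge0).
  have -> : Qmax = (1 - gamma) * Qmax + gamma * Qmax by ring.
  by rewrite lerD ?ler_wpM2l // (le_trans (reward_le _ _ _)).
rewrite (le_trans (ler_normD _ _)) // !normrM (ger0_norm alpha_ge0).
have a1 : 0 <= 1 - alpha by rewrite subr_ge0 ltW.
rewrite (ger0_norm a1) -[leRHS]mul1r -[X in X * Qmax](subrK alpha) [leRHS]mulrDl.
by rewrite lerD // ler_wpM2l.
Qed.

Lemma tderr_le h s a t :
  `|tderr (iterate h) s a t| <= Rmax X + (1 + gamma) * Qmax.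
Proof.
have iQ := iterate_norm_le h.
rewrite /tderr (le_trans (ler_normB _ _)) //.
have -> : Rmax X + (1 + gamma) * Qmax = Rmax X + gamma * Qmax + Qmax by ring.
rewrite lerD //; last first.
  exact: (le_trans (qval_le _ _ _)).
rewrite (le_trans (ler_normD _ _)) // lerD ?reward_le //.
rewrite normrM (ger0_norm gamma_ge0) ler_wpM2l //.
exact: (le_trans (Vmax_norm_le _ _)).
Qed.

Lemma iterate_noise_square h i :
  \sum_o q o * noise o (iterate h) i 0 ^+ 2 <= alpha ^+ 2 * Wmax X Q0.
Proof. by apply: noise_square => s a t; exact: tderr_le. Qed.

(** * Comparison of the error with a fixed linear system *)

Variables (Ms : 'M[R]_N) (Mof : qfun -> 'M[R]_N).
Hypothesis Ms_hull : convex_hull (Mset X d alpha) Ms.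
Hypothesis Ms_contract : forall x : qfun, `|Ms *m x| <= rho * `|x|.
Hypothesis Mof_hull : forall Q, convex_hull (Mset X d alpha) (Mof Q).
Hypothesis Mof_contract : forall Q (x : qfun), `|Mof Q *m x| <= rho * `|x|.
Hypothesis Mof_sub : forall Q (x : qfun),
  `|(Mof Q - Ms) *m x| <= 2 * alpha * gamma * dmax d * `|x|.
Hypothesis Mof_update : forall Q,
  Q - Qs + alpha *: (Dmx d *m (bellman X Q - Q)) = Mof Q *m (Q - Qs).

Let rho_ge0 : 0 <= rho.
Proof.
(* A contraction estimate on one nonzero vector forces its factor to be nonnegative. *)
pose x : qfun := const_mx 1.
have x0 : 0 < `|x|.
  by rewrite (lt_le_trans _ (cv_coord_le x ord0)) // mxE normr1.
by rewrite -(pmulr_lge0 _ x0) (le_trans (normr_ge0 (Ms *m x))).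
Qed.

Local Notation B := (alpha * Wmax X Q0 / (dmin d * (1 - gamma))).
Local Notation MsX h := (mxprod (fun=> Ms) (size h) *m e0).

(* The error is split as [MsX + lin_noise + switch_det + switch_noise]: the
   first two terms solve the linear system driven by [Ms] and the noise, the
   last two correct for switching to [Mof]. *)
Fixpoint lin_noise h : qfun :=
  if h is o :: h' then Ms *m lin_noise h' + noise o (iterate h') else 0.

Fixpoint switch_det h : qfun :=
  if h is _ :: h' then
    Mof (iterate h') *m switch_det h' + (Mof (iterate h') - Ms) *m MsX h'
  else 0.

Fixpoint switch_noise h : qfun :=
  if h is _ :: h' then
    Mof (iterate h') *m switch_noise h' + (Mof (iterate h') - Ms) *m lin_noise h'
  else 0.

(** Writing [Mof] as [Ms] plus a defect on the first two parts, the defect is exactly the input of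
    the two switching parts. *)
Lemma iterate_decomposition h :
  iterate h - Qs = MsX h + lin_noise h + switch_det h + switch_noise h.
Proof.
elim: h => [|o h IH] /=; first by rewrite mul1mx !addr0.
have -> : step o (iterate h) - Qs
    = Mof (iterate h) *m (iterate h - Qs) + noise o (iterate h).
  rewrite -Mof_update /noise.
  move: (iterate h) (step _ _) (alpha *: _) => U V W.
  by apply/matrixP => i j; rewrite !mxE; ring.
rewrite IH -mulmxA !mulmxDr !mulmxBl.
set A := Mof (iterate h).
move: (A *m MsX h) (A *m lin_noise h) (A *m switch_det h)
  (A *m switch_noise h) (noise o (iterate h)) (Ms *m MsX h) (Ms *m lin_noise h).
move=> A1 A2 A3 A4 n A5 A6.
by apply/matrixP => i j; rewrite !mxE; ring.
Qed.

Let Wmax_ge0 : 0 <= Wmax X Q0. Proof. exact: sqr_ge0. Qed.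
Let B_ge0 : 0 <= B.
Proof. by rewrite divr_ge0 ?(ltW dg_gt0) // mulr_ge0. Qed.

(** Given the past the noise has mean 0, so the cross term vanishes. The row sums of [Ms] are at
    most [rho], so a bound [B] on the old second moments becomes
    [rho ^+ 2 * B + alpha ^+ 2 * Wmax X Q0]. *)
Lemma lin_noise_square k i : E k (fun h => lin_noise h i 0 ^+ 2) <= B.
Proof.
have rows j := row_sum_le Ms_contract rho_ge0 j.
elim: k i => [|k IH] i /=; first by rewrite mxE expr0n.
apply: (@le_trans _ _ (E k (fun h =>
    rho * (\sum_j `|Ms i j| * lin_noise h j 0 ^+ 2)
    + alpha ^+ 2 * Wmax X Q0))).
  apply: (Ex_le q_ge0) => h _.
  set y := (Ms *m lin_noise h) i 0.
  have -> : \sum_o q o * (Ms *m lin_noise h + noise o (iterate h)) i 0 ^+ 2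
      = y ^+ 2 + \sum_o q o * noise o (iterate h) i 0 ^+ 2.
    transitivity (\sum_o (y ^+ 2 * q o
        + ((2 * y) * (q o * noise o (iterate h) i 0)
           + q o * noise o (iterate h) i 0 ^+ 2))).
      apply: eq_bigr => o _; rewrite [in LHS]mxE -/y.
      by move: (noise _ _ _ _) => n; ring.
    by rewrite !big_split /= -!mulr_sumr noise_mean q_sum1 mulr1 mulr0 add0r.
  by rewrite lerD ?iterate_noise_square // row_square_le.
rewrite ExD (ExZ _ k rho) (Ex_cst q_sum1) Ex_sum.
apply: (@le_trans _ _ (rho * (rho * B) + alpha ^+ 2 * Wmax X Q0)).
  rewrite lerD2r ler_wpM2l // (le_trans _ (ler_wpM2r B_ge0 (rows i))) //.
  rewrite mulr_suml; apply: ler_sum => j _.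
  by rewrite (ExZ _ k `|Ms i j|) ler_wpM2l.
(* [B] is the level at which [rho * B] plus the noise variance bound returns [B]; since
   [rho ^+ 2 <= rho], the recursion stays below it. *)
have BE : alpha ^+ 2 * Wmax X Q0 = (1 - rho) * B.
  by field; rewrite !gt_eqF // dmin_gt0.
have rho_le1 : rho <= 1 by rewrite lerBlDr lerDl mulr_ge0 // ltW.
rewrite BE [X in _ + X]mulrBl mul1r -lerBrDr opprB subrKC.
exact: ler_piMl (mulr_ge0 rho_ge0 B_ge0) rho_le1.
Qed.

(** The max norm is bounded by the sum of the coordinates, which produces the factor [N]. *)
Lemma lin_noise_norm k :
  E k (fun h => `|lin_noise h|) <= N%:R * Num.sqrt B.
Proof.
apply: (@le_trans _ _ (E k (fun h => \sum_i `|lin_noise h i 0|))).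
  apply: (Ex_le q_ge0) => h _; apply: cv_norm_le => [|i]; first exact: sumr_ge0.
  by rewrite (bigD1 i) //= lerDl sumr_ge0.
rewrite Ex_sum -[N in N%:R]card_ord mulr_natl -sumr_const.
apply: ler_sum => i _.
exact/(Ex_abs_le_sqrt q_ge0 q_sum1)/lin_noise_square.
Qed.

Lemma switch_noise_norm k : E k (fun h => `|switch_noise h|)
  <= 2 * gamma * dmax d / (dmin d * (1 - gamma)) * (N%:R * Num.sqrt B).
Proof.
set S := N%:R * _; set C := _ / _ * S.
have S0 : 0 <= S by rewrite mulr_ge0 ?sqrtr_ge0.
have C0 : 0 <= C by rewrite mulr_ge0 // divr_ge0 ?(ltW dg_gt0) // !mulr_ge0.
elim: k => [|k IH] /=; first by rewrite normr0.
apply: (@le_trans _ _ (E k (fun h => rho * `|switch_noise h|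
    + (2 * alpha * gamma * dmax d) * `|lin_noise h|))).
  apply: (Ex_le q_ge0) => h _.
  rewrite -mulr_suml q_sum1 mul1r (le_trans (ler_normD _ _)) // lerD //.
rewrite ExD !ExZ.
(* [C] solves [C = rho * C + 2 * alpha * gamma * dmax d * S]; the factor [alpha] cancels against
   [1 - rho]. *)
have CE : 2 * alpha * gamma * dmax d * S = (1 - rho) * C.
  by rewrite /C; field; rewrite !gt_eqF // dmin_gt0.
apply: (@le_trans _ _ (rho * C + 2 * alpha * gamma * dmax d * S)).
  by rewrite lerD // ler_wpM2l ?lin_noise_norm // !mulr_ge0.
by rewrite CE -mulrDl subrKC mul1r.
Qed.

Variables (K beta : R).
Hypothesis hull_growth : forall l (M : nat -> 'M[R]_N),
  seqs_in (convex_hull (Mset X d alpha)) l M ->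
  opnorm (mxprod M l) <= K * beta ^+ l.

Let K_ge0 : 0 <= K.
Proof.
(* The empty product has nonnegative norm, and its bound is [K]. *)
have := @hull_growth 0 (fun=> Ms); rewrite expr0 mulr1 => H.
by apply: le_trans (opnorm_ge0 _) (H _).
Qed.

(** The history-dependent matrices pile up on the left, so the induction carries an arbitrary
    product [mxprod M l] from the hull. Each input lies between two such products, one to its left
    and a power of [Ms] to its right: hence [K ^+ 2], and one factor [beta] fewer than there are
    steps. *)
Lemma switch_det_norm h l (M : nat -> 'M[R]_N) :
  seqs_in (convex_hull (Mset X d alpha)) l M ->
  `|mxprod M l *m switch_det h|
  <= 2 * alpha * gamma * dmax d * K ^+ 2
     * ((size h)%:R * beta ^+ (l + (size h).-1)) * `|e0|.
Proof.
elim: h l M => [|o h IH] l M HM /=.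
  by rewrite mulmx0 normr0 mul0r mulr0 mul0r.
set A := Mof _; set c := 2 * alpha * gamma * dmax d.
have c0 : 0 <= c by rewrite !mulr_ge0.
(* The new matrix acts first, hence takes index 0 and shifts the others. *)
pose M' i := if i is j.+1 then M j else A.
have HM' : seqs_in (convex_hull (Mset X d alpha)) l.+1 M'.
  by case=> [_|j jl]; [exact: Mof_hull | exact: HM].
have M'E : mxprod M l *m A = mxprod M' l.+1.
  rewrite -(addn1 l) mxprodD /= mulmx1; congr (_ *m _).
  by apply: eq_mxprod => i _; rewrite addn1.
rewrite mulmxDr mulmxA M'E (le_trans (ler_normD _ _)) //.
have -> : c * K ^+ 2 * ((size h).+1%:R * beta ^+ (l + size h)) * `|e0|
    = c * K ^+ 2 * ((size h)%:R * beta ^+ (l.+1 + (size h).-1)) * `|e0|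
      + (K * beta ^+ l) * (c * ((K * beta ^+ size h) * `|e0|)).
  (* Length 0 is separate because the truncated predecessor breaks the exponent identity there; the
     coefficient is then 0. *)
  case: (size h) => [|m] /=.
    by rewrite addn0 mul0r mulr0 mul0r add0r; ring.
  by rewrite addSnnS -natr1 exprD; ring.
rewrite lerD //; first exact: IH.
rewrite (le_trans (opnormP _ _)) // ler_pM ?opnorm_ge0 //; first exact: hull_growth.
rewrite (le_trans (Mof_sub _ _)) // ler_wpM2l // (le_trans (opnormP _ _)) //.
by rewrite ler_wpM2r // hull_growth.
Qed.

Lemma iterate_error_le k : E k (fun h => `|iterate h - Qs|)
  <= N%:R * Num.sqrt B * (1 + 2 * gamma * dmax d / (dmin d * (1 - gamma)))
     + K * beta ^+ k * `|e0|
     + 2 * alpha * gamma * dmax d * K ^+ 2 * (k%:R * beta ^+ k.-1) * `|e0|.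
Proof.
set S := N%:R * _; set u := K * _ * _; set v := _ * _ * `|e0|.
apply: (@le_trans _ _ (E k (fun h =>
    (`|lin_noise h| + `|switch_noise h|) + (u + v)))).
  apply: (Ex_le q_ge0) => h hk; rewrite iterate_decomposition.
  have uh : `|MsX h| <= u.
    rewrite hk (le_trans (opnormP _ _)) // ler_wpM2r // hull_growth //.
  have vh : `|switch_det h| <= v.
    have := @switch_det_norm h 0 (fun=> Ms); rewrite /= mul1mx hk add0n.
    by apply.
  rewrite (le_trans (ler_normD _ _)) //.
  rewrite (le_trans (lerD (ler_normD _ _) (lexx _))) //.
  rewrite (le_trans (lerD (lerD (ler_normD _ _) (lexx _)) (lexx _))) //.
  by move: uh vh; lra.
rewrite !ExD !(Ex_cst q_sum1) addrA.
have -> : S * (1 + 2 * gamma * dmax d / (dmin d * (1 - gamma)))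
    = S + 2 * gamma * dmax d / (dmin d * (1 - gamma)) * S by ring.
by rewrite !lerD // ?lin_noise_norm ?switch_noise_norm.
Qed.

End QLearningRecursion.

(** * The expected error of the Q-learning iterates *)

Theorem theorem3 (R : realType) (nS nA : nat) (X : mdp R nS nA)
  (p : 'I_nS.+1 -> R) (b : 'I_nS.+1 -> 'I_nA.+1 -> R)
  (hp : is_distr p) (hb : forall s, is_distr (b s))
  (d : 'I_nS.+1 -> 'I_nA.+1 -> R) (hd : forall s a, d s a = p s * b s a)
  (hd0 : forall s a, 0 < d s a)
  (alpha : R) (halpha0 : 0 < alpha) (halpha1 : alpha < 1)
  (Q0 : 'cV[R]_(nS.+1 * nA.+1))
  (disp : measure_display) (Omega : measurableType disp)
  (Pr : probability Omega R)
  (s : nat -> Omega -> 'I_nS.+1) (a : nat -> Omega -> 'I_nA.+1)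
  (s' : nat -> Omega -> 'I_nS.+1)
  (hobs : iid_observations Pr s a s' X d)
  (Q : nat -> Omega -> 'cV[R]_(nS.+1 * nA.+1))
  (hQ : forall k w,
    Q k w = q_iter X alpha Q0 (s ^~ w) (a ^~ w) (s' ^~ w) k)
  (Qstar : 'cV[R]_(nS.+1 * nA.+1)) (hQstar : bellman X Qstar = Qstar)
  (eps : R) (heps : 0 < eps)
  (beta : R) (hbeta : beta = jsr (Mset X d alpha) + eps) (hbeta1 : beta < 1)
  (K : R) (hK : K = growth_const (Mset X d alpha) beta)
  (k : nat) :
  ('E_Pr[(fun w => `|Q k w - Qstar|)%R]
   <= (nS.+1%:R * nA.+1%:R
         * Num.sqrt (alpha * Wmax X Q0 / (dmin d * (1 - disc X)))
         * (1 + 2 * disc X * dmax d / (dmin d * (1 - disc X)))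
       + K * beta ^+ k * `|Q0 - Qstar|
       + 2 * alpha * disc X * dmax d * K ^+ 2 * (k%:R * beta ^+ k.-1)
         * `|Q0 - Qstar|)%:E)%E.
Proof.
have d_sum1 : \sum_s \sum_a d s a = 1.
  rewrite -hp.2; apply: eq_bigr => x _; rewrite -[RHS]mulr1 -(hb x).2 mulr_sumr.
  by apply: eq_bigr => u _; exact: hd.
(* A switching matrix is selected for each Q-function; the policy behind it is kept to supply the
   norm estimates. *)
have /choice[Mof MofP] : forall Q' : 'cV[R]_(nS.+1 * nA.+1),
    exists M : 'M[R]_(nS.+1 * nA.+1), exists mu, [/\ forall s, is_distr (mu s),
      convex_hull (Mset X d alpha) (Mmx X d alpha mu), M = Mmx X d alpha mu
      & Q' - Qstar + alpha *: (Dmx d *m (bellman X Q' - Q'))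
        = M *m (Q' - Qstar)].
  move=> Q'.
  have [mu [mu1 mu2 mu3]] := expected_update_switching d alpha Q' hQstar.
  by exists (Mmx X d alpha mu), mu.
(* Any policy serves as the reference. *)
pose pi0 : 'I_nS.+1 -> 'I_nA.+1 := fun=> ord0.
pose Ms : 'M[R]_(nS.+1 * nA.+1) := Mmx X d alpha (onehot pi0).
have Ms_distr x : is_distr (@onehot R _ _ pi0 x) by exact: onehot_distr.
have contract mu (x : 'cV[R]_(nS.+1 * nA.+1)) : (forall s, is_distr (mu s)) ->
    `|Mmx X d alpha mu *m x| <= (1 - alpha * (dmin d * (1 - disc X))) * `|x|.
  exact: (Mmx_norm_le X hd0 halpha0 halpha1 d_sum1).
have Mset0 : Mset X d alpha !=set0 by exists Ms, pi0.
have Mset1 A : Mset X d alpha A -> opnorm A <= 1.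
  move=> [pi _ <-]; apply: opnorm_le => // x.
  rewrite (le_trans (contract (onehot pi) x _)) //; first exact: onehot_distr.
  rewrite ler_wpM2r // lerBlDr lerDl mulr_ge0 ?(ltW halpha0) //.
  by rewrite mulr_ge0 ?subr_ge0 ?(ltW (disc_lt1 X)) // ltW // dmin_gt0.
have rb : jsr (Mset X d alpha) < beta by rewrite hbeta ltrDl.
have KP l M : seqs_in (convex_hull (Mset X d alpha)) l M ->
    opnorm (mxprod M l) <= K * beta ^+ l.
  by rewrite hK; exact: (growth_constP Mset0 (lexx 1) Mset1 rb).
(* The error at time [k] depends only on the history, so its expectation becomes a finite sum. *)
rewrite (_ : (fun w => _) = (fun w =>
    `|iterate X alpha Q0 (history s a s' w k) - Qstar|)); last first.
  by apply/funext => w; rewrite hQ iterate_history.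
rewrite (expectation_history hobs k
  (f := fun h => `|iterate X alpha Q0 h - Qstar|)) // lee_fin -natrM.
apply: (iterate_error_le hd0 halpha0 halpha1 d_sum1 Q0 (Ms := Ms) (Mof := Mof)) => //.
- by apply: convex_hull_sub; exists pi0.
- by move=> x; exact: contract.
- by move=> Q'; have [mu [_ ? -> _]] := MofP Q'.
- by move=> Q' x; have [mu [? _ -> _]] := MofP Q'; exact: contract.
- move=> Q' x; have [mu [? _ -> _]] := MofP Q'.
  exact: (Mmx_sub_norm_le X hd0 halpha0).
- by move=> Q'; have [mu []] := MofP Q'.
Qed.
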